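(* Let $(\mathfrak{g}_1,\omega_1,j_1,\cdot_1)$ and $(\mathfrak{g}_2,\omega_2,j_2,\cdot_2)$ be two special Kähler Lie algebras, and write $L_{x_1}(y_1)=x_1\cdot_1y_1$ and $L'_{x_2}(y_2)=x_2\cdot_2y_2$. Suppose there exist two Lie algebra representations $\theta:\mathfrak{g}_1\to \mathfrak{kl}(\mathfrak{g}_2,\omega_2,j_2)$ and $\rho:\mathfrak{g}_2\to \mathfrak{kl}(\mathfrak{g}_1,\omega_1,j_1)$ such that for all $x_1\in\mathfrak{g}_1$, $x_2\in\mathfrak{g}_2$ $$L_{x_1}\circ\rho(x_2)-\rho(x_2)\circ L_{x_1}=\rho(\theta(x_1)(x_2))-L_{\rho(x_2)(x_1)},$$ $$L'_{x_2}\circ\theta(x_1)-\theta(x_1)\circ L'_{x_2}=\theta(\rho(x_2)(x_1))-L'_{\theta(x_1)(x_2)}.$$ Then the vector space $\mathfrak{g}_1\oplus \mathfrak{g}_2$ equipped with (for $x_1,y_1\in\mathfrak{g}_1$, $x_2,y_2\in\mathfrak{g}_2$) (i) the Lie bracket $[x_1+x_2,y_1+y_2]_\dagger=[x_1,y_1]_{\mathfrak{g}_1}+\rho(x_2)(y_1)-\rho(y_2)(x_1)+\theta(x_1)(y_2)-\theta(y_1)(x_2)+[x_2,y_2]_{\mathfrak{g}_2}$, (ii) the non-degenerate scalar 2-cocycle $\omega(x_1+x_2,y_1+y_2)=\omega_1(x_1,y_1)+\omega_2(x_2,y_2)$, (iii) the left symmetric product $(x_1+x_2)\cdot(y_1+y_2)=L_{x_1}(y_1)+\rho(x_2)(y_1)+\theta(x_1)(y_2)+L'_{x_2}(y_2)$,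 (iv) and the integrable complex structure $j(x_1+x_2)=j_1(x_1)+j_2(x_2)$, is another special Kähler Lie algebra.
   Context: Special Kähler Lie algebra: a finite dimensional real Lie algebra $\mathfrak{g}$ with a triple $(\omega,j,\cdot)$ where $\omega$ is a non-degenerate skew-symmetric bilinear form that is a scalar 2-cocycle ($\omega([x,y],z)+\omega([y,z],x)+\omega([z,x],y)=0$); $j$ is an integrable complex structure ($j^2=-\mathrm{Id}$, $[jx,jy]-[x,y]=j[jx,y]+j[x,jy]$); $\cdot$ is a left symmetric product ($x\cdot(y\cdot z)-(x\cdot y)\cdot z=y\cdot(x\cdot z)-(y\cdot x)\cdot z$); and for all $x,y,z$: (i) $k(x,y)=\omega(x,j(y))$ is symmetric and non-degenerate; (ii) $[x,y]=x\cdot y-y\cdot x$; (iii) $\omega(x\cdot y,z)+\omega(y,x\cdot z)=0$; (iv) $j([x,y])=x\cdot j(y)-y\cdot j(x)$. $\mathfrak{kl}(V,\omega,J)$ denotes the Lie algebra of all $A\in\mathfrak{gl}(V)$ with $\omega(A(x),y)+\omega(x,A(y))=0$ for all $x,y\in V$ and $AJ=JA$. *)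

(* Defs.v *)
(* Multilinear operations are unbundled: they are plain functions whose
   linearity is a field of the corresponding predicate. *)
From HB Require Import structures.
From mathcomp Require Import all_boot all_order all_algebra.
From mathcomp Require Import reals.

Set Implicit Arguments.
Unset Strict Implicit.
Unset Printing Implicit Defensive.

Import GRing.Theory.
Local Open Scope ring_scope.

Section SpecialKahler.
Variables (R : realType) (V : vectType R).
Implicit Types (br dot : V -> V -> V) (omega k : V -> V -> R) (j : V -> V).

Record lie_bracket br : Prop := LieBracket {
  lie_bilinear : bilinear_for *:%R *:%R br;
  lie_alternating : forall x, br x x = 0;
  lie_jacobi : forall x y z,
    br x (br y z) + br y (br z x) + br z (br x y) = 0
}.

(* One-sided, which suffices as it is only used for (skew-)symmetric forms;
   the library's [nondegenerate] requires a bundled hermitian form, see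
   [nondegenerate_formP] below. *)
Definition nondegenerate_form k : Prop :=
  forall x, (forall y, k x y = 0) -> x = 0.

Record nondeg_scalar_2cocycle br omega : Prop := NondegScalar2cocycle {
  cocycle_bilinear : bilinear_for *%R *%R omega;
  cocycle_skew : forall x y, omega x y = - omega y x;
  cocycle_nondeg : nondegenerate_form omega;
  cocycle_closed : forall x y z,
    omega (br x y) z + omega (br y z) x + omega (br z x) y = 0
}.

Record integrable_complex_structure br j : Prop := IntegrableComplexStructure {
  cstruct_linear : linear j;
  cstruct_sqr : forall x, j (j x) = - x;
  cstruct_integrable : forall x y,
    br (j x) (j y) - br x y = j (br (j x) y) + j (br x (j y))
}.

Record left_symmetric_product dot : Prop := LeftSymmetricProduct {
  lsp_bilinear : bilinear_for *:%R *:%R dot;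
  lsp_symmetric : forall x y z,
    dot x (dot y z) - dot (dot x y) z = dot y (dot x z) - dot (dot y x) z
}.

Record special_kahler br omega j dot : Prop := SpecialKahler {
  sk_lie : lie_bracket br;
  sk_cocycle : nondeg_scalar_2cocycle br omega;
  sk_cstruct : integrable_complex_structure br j;
  sk_lsp : left_symmetric_product dot;
  sk_metric_sym : forall x y, omega x (j y) = omega y (j x);
  sk_metric_nondeg : nondegenerate_form (fun x y => omega x (j y));
  sk_torsion_free : forall x y, br x y = dot x y - dot y x;
  sk_parallel : forall x y z, omega (dot x y) z + omega y (dot x z) = 0;
  sk_special : forall x y, j (br x y) = dot x (j y) - dot y (j x)
}.

Definition kl omega j (A : 'End(V)) : Prop :=
  (forall x y, omega (A x) y + omega x (A y) = 0) /\
  (forall x, A (j x) = j (A x)).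

End SpecialKahler.

Lemma nondegenerate_formP (R : realType) (V : vectType R) (eps : bool)
    (k : {hermitian V for eps & (idfun : {rmorphism R -> R})}) :
  nondegenerate k <-> nondegenerate_form k.
Proof.
split=> [/eqP rad0 x kx0|k_nd].
  by apply/eqP; rewrite -memv0 -rad0; apply/mem_orthovP => y _; exact: kx0.
apply/eqP/eqP; rewrite -subv0; apply/subvP => x /mem_orthovP kx0.
by rewrite memv0 (k_nd x) // => y; exact/kx0/memvf.
Qed.

Record kl_representation (R : realType) (g V : vectType R)
    (br : g -> g -> g) (omega : V -> V -> R) (j : V -> V)
    (phi : g -> 'End(V)) : Prop := KlRepresentation {
  klrep_linear : linear phi;
  klrep_kl : forall x, kl omega j (phi x);
  klrep_bracket : forall x y,
    phi (br x y) = (phi x \o phi y)%VF - (phi y \o phi x)%VF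
}.

(* The direct sum is the product type [g1 * g2], with [x1 + x2] encoded as
   the pair [(x1, x2)]. *)
Section DirectSum.
Variables (R : realType) (g1 g2 : vectType R).
Variables (theta : g1 -> 'End(g2)) (rho : g2 -> 'End(g1)).
Implicit Types x y : g1 * g2.

Definition dsum_bracket (br1 : g1 -> g1 -> g1) (br2 : g2 -> g2 -> g2) x y
    : g1 * g2 :=
  (br1 x.1 y.1 + rho x.2 y.1 - rho y.2 x.1,
   theta x.1 y.2 - theta y.1 x.2 + br2 x.2 y.2).

Definition dsum_form (omega1 : g1 -> g1 -> R) (omega2 : g2 -> g2 -> R) x y
    : R :=
  omega1 x.1 y.1 + omega2 x.2 y.2.

Definition dsum_product (dot1 : g1 -> g1 -> g1) (dot2 : g2 -> g2 -> g2) x y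
    : g1 * g2 :=
  (dot1 x.1 y.1 + rho x.2 y.1, theta x.1 y.2 + dot2 x.2 y.2).

Definition dsum_cstruct (j1 : g1 -> g1) (j2 : g2 -> g2) x : g1 * g2 :=
  (j1 x.1, j2 x.2).

End DirectSum.

(* Main.v *)
From HB Require Import structures.
Require Import Defs.
From mathcomp Require Import all_boot all_order all_algebra.
From mathcomp Require Import reals ring.
Import GRing.Theory.

Set Implicit Arguments.
Unset Strict Implicit.
Unset Printing Implicit Defensive.

Local Open Scope ring_scope.

(** In a special Kähler Lie algebra the bracket is the commutator of the
    product, and left symmetry says precisely that the left multiplications
    satisfy [L_[x,y] = L_x L_y - L_y L_x], i.e. that they form a flat
    torsion-free connection.  Granting that, four of the required identities
    are consequences of the others: Jacobi is the first Bianchi identity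
    (lemma [commutator_lie_bracket]), closedness of [omega] follows from
    [omega] being parallel ([parallel_closed]), integrability of [j] follows
    from [j [x,y] = x (j y) - y (j x)] ([special_integrable]), and
    non-degeneracy of [omega (-, j -)] from that of [omega].  These reductions
    are collected in [special_kahler_of_flat].

    For the direct sum the only identity of substance is therefore the flatness
    of its product.  Left multiplication by [(x1, x2)] is block diagonal, with
    blocks [L_x1 + rho x2] and [theta x1 + L'_x2], so flatness can be checked
    on each block.  On the first block, the cross terms of the commutator of
    [L_x1 + rho x2] and [L_y1 + rho y2] are the commutators of an [L] with a
    [rho], and the first compatibility condition states exactly that these equal
    the action of the cross terms of the bracket ([dsum_block_flat]).  The second
    block is the same statement with the roles of the two algebras exchanged.
    The remaining identities hold because [theta] and [rho] act by linear maps
    that are skew for the forms and commute with the complex structures. *)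

(** * Additivity of unbundled bilinear maps *)

Section Additivity.
Variables (R : nzRingType) (U : lmodType R) (V : zmodType).
Variable s : GRing.Scale.law R V.

Lemma linear_forB (f : U -> V) :
  GRing.linear_for s f -> {morph f : x y / x - y}.
Proof.
move=> f_lin.
pose F : {linear U -> V | s} :=
  HB.pack f (GRing.isLinear.Build R U V s f f_lin).
exact: (linearB F).
Qed.

Lemma linear_for0 (f : U -> V) : GRing.linear_for s f -> f 0 = 0.
Proof. by move=> /linear_forB fB; rewrite -(subrr (0 : U)) fB subrr. Qed.

Lemma linear_forN (f : U -> V) : GRing.linear_for s f -> {morph f : x / - x}.
Proof.
by move=> f_lin x; rewrite -[- x]sub0r linear_forB // linear_for0 // sub0r.
Qed.

Lemma linear_forD (f : U -> V) :
  GRing.linear_for s f -> {morph f : x y / x + y}.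
Proof.
by move=> f_lin x y; rewrite -{1}[y]opprK linear_forB // linear_forN // opprK.
Qed.

End Additivity.

Section Biadditivity.
Variables (R : nzRingType) (U U' : lmodType R) (V : zmodType).
Variables (s s' : GRing.Scale.law R V).
Variables (f : U -> U' -> V) (f_bilin : bilinear_for s s' f).

Lemma bilinear_forDl z : {morph f^~ z : x y / x + y}.
Proof. exact: linear_forD (f_bilin.1 z). Qed.

Lemma bilinear_forBl z : {morph f^~ z : x y / x - y}.
Proof. exact: linear_forB (f_bilin.1 z). Qed.

Lemma bilinear_forDr x : {morph f x : y z / y + z}.
Proof. exact: linear_forD (f_bilin.2 x). Qed.

Lemma bilinear_forBr x : {morph f x : y z / y - z}.
Proof. exact: linear_forB (f_bilin.2 x). Qed.

End Biadditivity.

(** * Special Kähler structures from flat torsion-free products *)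

Lemma eq_subr_exchange (V : zmodType) (a b c d : V) :
  (a - b == c - d) = (a - c == b - d).
Proof. by rewrite !subr_eq addrAC [c + b]addrC [b - d + c]addrAC. Qed.

Section FromFlat.
Variables (R : realType) (V : vectType R).
Variables (br dot : V -> V -> V) (omega : V -> V -> R) (j : V -> V).
Hypothesis dot_bilin : bilinear_for *:%R *:%R dot.
Hypothesis torsion_free : forall x y, br x y = dot x y - dot y x.

Definition flat :=
  forall x y z, dot (br x y) z = dot x (dot y z) - dot y (dot x z).

(** The two conditions differ by moving two terms across the equality, once
    [br x y] is expanded as a commutator. *)
Lemma left_symmetric_flatP : left_symmetric_product dot <-> flat.
Proof.
split=> [[_ lsp] x y z|dot_flat].
  rewrite torsion_free (bilinear_forBl dot_bilin); apply/eqP.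
  by rewrite eq_sym -eq_subr_exchange; apply/eqP.
split=> // x y z; apply/eqP; rewrite eq_subr_exchange -dot_flat torsion_free.
by rewrite (bilinear_forBl dot_bilin).
Qed.

(** Flatness turns [br x (br y z)] into an alternating sum of iterated products
    [a (b c)], each of which occurs twice in the cyclic sum, with opposite
    signs. *)
Lemma commutator_lie_bracket : flat -> lie_bracket br.
Proof.
move=> dot_flat; split.
- split=> z a x y; rewrite !torsion_free (dot_bilin.1 z) (dot_bilin.2 z) /=;
    by rewrite opprD addrACA -scalerBr.
- by move=> x; rewrite torsion_free subrr.
pose S a b c := dot a (dot b c) + dot c (dot b a).
have brbr a b c : br a (br b c) = S a b c - S b c a.
  rewrite [LHS]torsion_free dot_flat torsion_free (bilinear_forBr dot_bilin) /S.
  by rewrite opprB addrACA -opprD [dot b _ + _]addrC.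
by move=> x y z; rewrite !brbr !subrKA subrr.
Qed.

(** With [omega] skew, parallelism says that [omega (dot a b) c] is symmetric in
    [b] and [c]; the six terms of the cyclic sum of commutators then cancel in
    pairs. *)
Lemma parallel_closed :
    bilinear_for *%R *%R omega -> (forall x y, omega x y = - omega y x) ->
    (forall x y z, omega (dot x y) z + omega y (dot x z) = 0) ->
  forall x y z, omega (br x y) z + omega (br y z) x + omega (br z x) y = 0.
Proof.
move=> omega_bilin skew parallel.
have move_dot a b c : omega (dot a b) c = omega (dot a c) b.
  by rewrite [RHS]skew -[RHS]add0r -(parallel a b c) addrK.
move=> x y z; rewrite !torsion_free !(bilinear_forBl omega_bilin).
rewrite (move_dot y x z) (move_dot z y x) (move_dot x z y); ring.
Qed.

(** As [j] squares to [-1], the hypothesis expands the right-hand side into four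
    products, which are those of the two commutators on the left. *)
Lemma special_integrable : (forall x, j (j x) = - x) ->
    (forall x y, j (br x y) = dot x (j y) - dot y (j x)) ->
  forall x y, br (j x) (j y) - br x y = j (br (j x) y) + j (br x (j y)).
Proof.
move=> j_sqr special x y.
have dotN a b : dot a (- b) = - dot a b by exact: linear_forN (dot_bilin.2 a) b.
by rewrite !special !j_sqr !dotN opprK !torsion_free opprB addrACA [- _ + _]addrC.
Qed.

Lemma special_kahler_of_flat :
    flat -> bilinear_for *%R *%R omega -> (forall x y, omega x y = - omega y x) ->
    nondegenerate_form omega ->
    linear j -> (forall x, j (j x) = - x) ->
    (forall x y, omega x (j y) = omega y (j x)) ->
    (forall x y z, omega (dot x y) z + omega y (dot x z) = 0) ->
    (forall x y, j (br x y) = dot x (j y) - dot y (j x)) ->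
  special_kahler br omega j dot.
Proof.
move=> dot_flat omega_bilin skew nondeg j_lin j_sqr sym parallel special.
split=> //.
- exact: commutator_lie_bracket.
- by split=> //; exact: parallel_closed.
- by split=> //; exact: special_integrable.
- exact/left_symmetric_flatP.
- (* Every vector is a value of [j], since [y = j (- j y)]. *)
  move=> x x_rad; apply: nondeg => y.
  by rewrite -(x_rad (- j y)) (linear_forN j_lin) j_sqr opprK.
Qed.

End FromFlat.

(** * Flatness of the direct sum *)

Lemma klrep_bracketE (R : realType) (g V : vectType R) (br : g -> g -> g)
    (omega : V -> V -> R) (j : V -> V) (phi : g -> 'End(V)) :
    kl_representation br omega j phi ->
  forall x y v, phi (br x y) v = phi x (phi y v) - phi y (phi x v).
Proof.
by case=> _ _ phi_br x y v; rewrite phi_br add_lfunE opp_lfunE !comp_lfunE.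
Qed.

(** Flatness of one diagonal block of the product.  The terms in
    [rho (theta _ _)] cancel against those that the compatibility condition
    produces from [dot (rho _ _)], leaving the commutators of [dot] with
    [rho]. *)
Lemma dsum_block_flat (R : realType) (g h : vectType R)
    (brg dot : g -> g -> g) (brh : h -> h -> h)
    (omega : g -> g -> R) (j : g -> g)
    (theta : g -> 'End(h)) (rho : h -> 'End(g))
    (dot_bilin : bilinear_for *:%R *:%R dot) (dot_flat : flat brg dot)
    (rho_rep : kl_representation brh omega j rho)
    (compat : forall (x1 : g) (x2 : h),
      (dot x1 \o rho x2) \- (rho x2 \o dot x1)
      =1 rho (theta x1 x2) \- dot (rho x2 x1))
    (x1 y1 z : g) (x2 y2 : h) :
  dot (brg x1 y1 + rho x2 y1 - rho y2 x1) z
    + rho (theta x1 y2 - theta y1 x2 + brh x2 y2) z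
  = dot x1 (dot y1 z + rho y2 z) + rho x2 (dot y1 z + rho y2 z)
    - (dot y1 (dot x1 z + rho x2 z) + rho y2 (dot x1 z + rho x2 z)).
Proof.
have dot_rho a b : dot (rho b a) z =
    rho (theta a b) z - (dot a (rho b z) - rho b (dot a z)).
  have /= := compat a b z => ->.
  by rewrite opprB addrCA subrr addr0.
have [rho_lin _ _] := rho_rep.
rewrite (bilinear_forBl dot_bilin) (bilinear_forDl dot_bilin) /= dot_flat.
rewrite (linear_forD rho_lin) (linear_forB rho_lin) add_lfunE add_lfunE opp_lfunE.
rewrite (klrep_bracketE rho_rep) !dot_rho !(bilinear_forDr dot_bilin).
rewrite ![rho _ (_ + _)]linearD /= !opprD !opprK !addrA.
(* Of the twelve summands on the left, the 3rd and 10th, and the 9th and 6th, are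
   the cancelling terms in [rho (theta _ _)]. *)
by rewrite [LHS](ACl ((1*7*5*11*2*4*8*12)*(3*10)*(9*6)))%AC /= !subrr !addr0.
Qed.

Unset Implicit Arguments.

Theorem theorem4p2 (R : realType) (g1 g2 : vectType R)
    (br1 : g1 -> g1 -> g1) (omega1 : g1 -> g1 -> R)
    (j1 : g1 -> g1) (dot1 : g1 -> g1 -> g1)
    (br2 : g2 -> g2 -> g2) (omega2 : g2 -> g2 -> R)
    (j2 : g2 -> g2) (dot2 : g2 -> g2 -> g2)
    (sk1 : special_kahler br1 omega1 j1 dot1)
    (sk2 : special_kahler br2 omega2 j2 dot2)
    (theta : g1 -> 'End(g2)) (rho : g2 -> 'End(g1))
    (theta_rep : kl_representation br1 omega2 j2 theta)
    (rho_rep : kl_representation br2 omega1 j1 rho)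
    (compat1 : forall (x1 : g1) (x2 : g2),
      (dot1 x1 \o rho x2) \- (rho x2 \o dot1 x1)
      =1 rho (theta x1 x2) \- dot1 (rho x2 x1))
    (compat2 : forall (x1 : g1) (x2 : g2),
      (dot2 x2 \o theta x1) \- (theta x1 \o dot2 x2)
      =1 theta (rho x2 x1) \- dot2 (theta x1 x2)) :
  special_kahler (dsum_bracket theta rho br1 br2) (dsum_form omega1 omega2)
    (dsum_cstruct j1 j2) (dsum_product theta rho dot1 dot2).
Proof.
have [_ [ob1 os1 on1 _] [jl1 jj1 _] lsp1 sym1 _ tf1 par1 spe1] := sk1.
have [_ [ob2 os2 on2 _] [jl2 jj2 _] lsp2 sym2 _ tf2 par2 spe2] := sk2.
have [theta_lin theta_kl _] := theta_rep.
have [rho_lin rho_kl _] := rho_rep.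
have db1 := lsp_bilinear lsp1; have db2 := lsp_bilinear lsp2.
apply: special_kahler_of_flat => //.
- split=> [z|x] a u v; congr pair => /=.
  + by rewrite (db1.1 z.1) rho_lin add_lfunE scale_lfunE scalerDr addrACA.
  + by rewrite (db2.1 z.2) theta_lin add_lfunE scale_lfunE scalerDr addrACA.
  + by rewrite (db1.2 x.1) linearP scalerDr addrACA.
  + by rewrite (db2.2 x.2) linearP scalerDr addrACA.
- move=> x y; congr pair => /=.
  + by rewrite tf1 opprD [RHS]addrACA addrA.
  + by rewrite tf2 opprD [RHS]addrACA.
- have flat1 := (left_symmetric_flatP db1 tf1).1 lsp1.
  have flat2 := (left_symmetric_flatP db2 tf2).1 lsp2.
  move=> x y z; congr pair => /=.
  + exact: (dsum_block_flat db1 flat1 rho_rep compat1).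
  (* The second block, with the summands put in the order in which they appear
     when the two algebras are exchanged. *)
  have := dsum_block_flat db2 flat2 theta_rep (fun a b => compat2 b a)
            x.2 y.2 z.2 x.1 y.1.
  rewrite -[br1 _ _ + _ - _]addrA [br1 _ _ + _]addrC.
  by rewrite [_ + br2 _ _]addrC addrA ![_ + dot2 _ _]addrC.
- split=> [z|x] a u v; rewrite /dsum_form /=.
  + by rewrite (ob1.1 z.1) (ob2.1 z.2) /= mulrDr addrACA.
  + by rewrite (ob1.2 x.1) (ob2.2 x.2) /= mulrDr addrACA.
- by move=> x y; rewrite /dsum_form opprD -os1 -os2.
- case=> x1 x2 x_rad; congr pair.
  + apply: on1 => y; have := x_rad (y, 0).
    by rewrite /dsum_form /= (linear_for0 (ob2.2 x2)) addr0.
  + apply: on2 => y; have := x_rad (0, y).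
    by rewrite /dsum_form /= (linear_for0 (ob1.2 x1)) add0r.
- by move=> a u v; congr pair; rewrite /= ?jl1 ?jl2.
- by move=> x; congr pair; rewrite /= ?jj1 ?jj2.
- by move=> x y; rewrite /dsum_form /= sym1 sym2.
- move=> x y z; rewrite /dsum_form /= addrACA.
  rewrite !(bilinear_forDl ob1) !(bilinear_forDr ob1).
  rewrite !(bilinear_forDl ob2) !(bilinear_forDr ob2).
  rewrite [omega1 _ _ + omega1 _ _ + _]addrACA par1 (rho_kl x.2).1 !add0r.
  by rewrite addrACA par2 (theta_kl x.1).1 addr0.
- move=> x y; congr pair => /=.
  + rewrite (linear_forB jl1) (linear_forD jl1) spe1.
    by rewrite -!(rho_kl _).2 opprD [RHS]addrACA addrA.
  + rewrite (linear_forD jl2) (linear_forB jl2) spe2.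
    by rewrite -!(theta_kl _).2 opprD [RHS]addrACA.
Qed.
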